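(* Let $a>1$, $m\ge0$ and $(x,u,\eta)\in\mathbb{R}^3$. For every $j=0,1,\dots,n$ set $\omega_j=1-\frac{2j}{n}$, and let $S_n^{h_m,x}(t,a)=h_m(t-x)F_n(t,a)$. Then $$V_{h_m}(S_n^{h_m,x})(u,\eta)=\sqrt\pi\, e^{\frac{xu-i(u+x)\eta}{2}}e^{-\frac{x^2+u^2+\eta^2}{4}}\sum_{j=0}^nC_j(n,a)\,e^{\frac12\left[i\omega_j(u+x)+\omega_j\eta-\frac{\omega_j^2}{2}\right]}L_m^0\left(\frac{(x-u)^2+(\omega_j-\eta)^2}{2}\right),$$ where $L_m^0$ are the Laguerre polynomials.
   Context: Hermite functions: $h_m(t)=e^{-t^2/2}H_m(t)=(-1)^me^{t^2/2}\frac{d^m}{dt^m}(e^{-t^2})$, $m=0,1,\dots$, where $H_m$ are the Hermite polynomials. The short-time Fourier transform of $f\in L^2(\mathbb{R})$ with window $g\in L^2(\mathbb{R})$ is $V_g(f)(x,\omega)=\int_{\mathbb{R}}e^{-it\omega}\overline{g(t-x)}f(t)\,dt$. The superoscillating sequence, $n\in\mathbb{N}$, is $F_n(t,a)=\sum_{j=0}^nC_j(n,a)e^{i(1-2j/n)t}$ with $C_j(n,a)=\binom{n}{j}\left(\frac{1+a}{2}\right)^{n-j}\left(\frac{1-a}{2}\right)^j$. Laguerre polynomials: $L_m^0(y)=\sum_{i=0}^m(-1)^i\binom{m}{m-i}\frac{y^i}{i!}$.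
   Formalization: The right-hand side carries an extra factor 2^m m!, absent from the printed formula, which is false for m ≥ 1 with the given unnormalised h_m (at m=n=1, x=u=η=0 it is off by a factor 2); for m=0 the two formulas agree. n ≥ 1 is assumed so that ω_j is defined. *)

(* Defs.v *)
From HB Require Import structures.
From mathcomp Require Import all_boot all_order all_algebra.
From mathcomp Require Import all_classical all_reals all_analysis.
From mathcomp Require Export complex.

Set Implicit Arguments.
Unset Strict Implicit.
Unset Printing Implicit Defensive.

Import Order.TTheory GRing.Theory Num.Theory.
Import numFieldNormedType.Exports.

Local Open Scope classical_set_scope.
Local Open Scope ring_scope.
Local Open Scope complex_scope.

Definition expC (R : realType) (z : R[i]) : R[i] :=
  let: a +i* b := z in (expR a * cos b) +i* (expR a * sin b).

(* Real and imaginary parts are Lebesgue integrals over the whole line; as for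
   Rintegral, the value is only meaningful when both parts are integrable. *)
Definition Cintegral (R : realType) (f : R -> R[i]) : R[i] :=
  (\int[lebesgue_measure]_t complex.Re (f t)) +i*
  (\int[lebesgue_measure]_t complex.Im (f t)).

(* Physicists' Hermite polynomials, by the Rodrigues formula. *)
Definition hermite_poly (R : realType) (m : nat) (t : R) : R :=
  (-1) ^+ m * expR (t ^+ 2) * derive1n m (fun s : R => expR (- s ^+ 2)) t.

(* These are not normalised: the square of the L^2 norm of the m-th Hermite
   function is sqrt pi * 2 ^ m * m!. *)
Definition hermite_fun (R : realType) (m : nat) (t : R) : R :=
  expR (- t ^+ 2 / 2) * hermite_poly m t.

Definition laguerre (R : realType) (m : nat) (y : R) : R :=
  \sum_(0 <= i < m.+1) (-1) ^+ i * ('C(m, m - i))%:R * (y ^+ i / (i`!)%:R).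

(* Short-time Fourier transform of f with window g; the library has no space of
   complex-valued square-integrable functions, so that f and g are arbitrary. *)
Definition stft (R : realType) (g f : R -> R[i]) (x w : R) : R[i] :=
  Cintegral (fun t => expC (- 'i%C * t%:C * w%:C) * conjc (g (t - x)) * f t).

Definition superosc_coef (R : realType) (j n : nat) (a : R) : R :=
  ('C(n, j))%:R * ((1 + a) / 2) ^+ (n - j) * ((1 - a) / 2) ^+ j.

Definition superosc_freq (R : realType) (j n : nat) : R :=
  1 - 2 * j%:R / n%:R.

Definition superosc (R : realType) (n : nat) (t a : R) : R[i] :=
  \sum_(0 <= j < n.+1)
    (superosc_coef j n a)%:C * expC ('i%C * (superosc_freq R j n)%:C * t%:C).

Definition hermite_superosc (R : realType) (n m : nat) (x t a : R) : R[i] :=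
  (hermite_fun m (t - x))%:C * superosc n t a.

(* Main.v *)
From HB Require Import structures.
Require Import Defs.
From mathcomp Require Import all_boot all_order all_algebra.
From mathcomp Require Import all_classical all_reals all_analysis.
From mathcomp Require Import complex.
From mathcomp Require Import measurable_realfun ring lra.

(** After the change of variable [t = s + (u + x) / 2], the contribution of the
    frequency [w] of the superoscillating sequence is, up to explicit exponential
    factors, the integral of [H_m (s + p) * H_m (s - p)] against
    [exp (- s ^ 2 + i * xi * s)], with [p = (x - u) / 2] and [xi = w - eta]. Let
    [E] denote integration of polynomials against this weight. The theorem reduces
    to

      [E (H_m (s + p) * H_m (s - p)) =
         2 ^ m * m! * L_m (2 * p ^ 2 + xi ^ 2 / 2) * E 1],
      [E 1 = sqrt pi * exp (- xi ^ 2 / 4)].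

    The first identity is algebra, and uses only that the integral of a derivative
    vanishes: [E (2 * X * P - P') = z * E P] with [z = i * xi]
    ([gaussian_functional_parts]). The translate [H_m (X + p)] is obtained from [1]
    by iterating [P |-> (2 * X + 2 * p) * P - P'], whose transpose under [E] is
    [Q |-> (z + 2 * p) * Q + Q'] ([functional_raise]). Moving all the iterations to
    the factor [Q = H_m (X - p)] expands the left-hand side as a binomial sum of
    the [E (Q^(k))]. Here [Q^(k)] is a multiple of [H_(m - k) (X - p)], and [E]
    takes the value [(z - 2 * p) ^ (m - k) * E 1] on the latter, by the same
    transposition applied to [1]. The product
    [(z + 2 * p) * (z - 2 * p) = - (xi ^ 2 + 4 * p ^ 2)] is what turns the sum into
    a Laguerre polynomial ([functional_hermite_product], [laguerreE]).

    The analysis supplies the hypotheses of this computation: integrals of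
    functions of Gaussian decay are linear, invariant under translation
    ([integral_shift]) and vanish on derivatives ([integral_derivative]), and the
    Fourier transform of the Gaussian follows from a first-order differential
    equation in the frequency ([gaussian_cos_transform]). *)

Set Implicit Arguments.
Unset Strict Implicit.
Unset Printing Implicit Defensive.

Import Order.TTheory GRing.Theory Num.Theory.
Import numFieldNormedType.Exports.

Local Open Scope classical_set_scope.
Local Open Scope ring_scope.
Local Open Scope complex_scope.

(** * Shifted Hermite polynomials *)

Definition hermite_raise (C : comNzRingType) (b : C) (P : {poly C}) : {poly C} :=
  (2 *: 'X + b%:P) * P - P^`().

(** The Hermite polynomial [H_m] translated by [b / 2]. Keeping the translation
    inside the raising operator makes every translate come from the constant [1]
    by iteration, which is what integration by parts can undo. *)
Definition shifted_hermite (C : comNzRingType) (b : C) (m : nat) : {poly C} :=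
  iter m (hermite_raise b) 1.

Lemma shifted_hermiteS (C : comNzRingType) (b : C) (m : nat) :
  shifted_hermite b m.+1 = (2 *: 'X + b%:P) * shifted_hermite b m
                           - (shifted_hermite b m)^`().
Proof. by []. Qed.

(** [c] plus differentiation: the transpose of the raising operator under the
    functionals of [functional_raise]. *)
Definition hermite_raise_dual (C : comNzRingType) (c : C) (Q : {poly C}) : {poly C} :=
  c *: Q + Q^`().

Lemma deriv_shifted_hermite (C : comNzRingType) (b : C) (n : nat) :
  (shifted_hermite b n.+1)^`() = (2 * n.+1%:R) *: shifted_hermite b n.
Proof.
elim: n => [|n IH].
  rewrite /shifted_hermite /= /hermite_raise mulr1 derivB derivD derivZ derivX.
  by rewrite !derivC subr0 addr0 mulr1.
rewrite (shifted_hermiteS _ n.+1) derivB derivM derivD derivZ derivX derivC.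
rewrite IH derivZ shifted_hermiteS.
rewrite -!mul_polyC -[n.+2]addn1 natrD !polyCM !polyCD.
ring.
Qed.

Lemma derivn_shifted_hermite (C : comNzRingType) (b : C) (m k : nat) :
  (k <= m)%N ->
  (shifted_hermite b m)^`(k) =
  (2 ^+ k * (m ^_ k)%:R) *: shifted_hermite b (m - k).
Proof.
elim: k => [|k IH] km; first by rewrite subn0 expr0 ffactn0 mulr1 scale1r.
rewrite derivnS IH; last exact: ltnW.
rewrite derivZ subnS -(prednK (n := m - k)) ?subn_gt0 // deriv_shifted_hermite.
rewrite scalerA ffactnSr prednK ?subn_gt0 // exprSr natrM; congr (_ *: _).
ring.
Qed.

(** Multiplication by [c] commutes with differentiation, so this is the binomial
    formula for a power of their sum. *)
Lemma iter_hermite_raise_dual (C : comNzRingType) (c : C) (m : nat) (Q : {poly C}) :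
  iter m (hermite_raise_dual c) Q =
  \sum_(i < m.+1) ('C(m, i)%:R * c ^+ i) *: Q^`(m - i).
Proof.
elim: m => [|m IH].
  by rewrite big_ord1 /= mulr1 scale1r.
rewrite iterS IH /hermite_raise_dual scaler_sumr raddf_sum /=.
have -> : \sum_(i < m.+1) c *: (('C(m, i)%:R * c ^+ i) *: Q^`(m - i)) =
    \sum_(i < m.+1) ('C(m, i)%:R * c ^+ i.+1) *: Q^`(m - i).
  by apply: eq_bigr => i _; rewrite scalerA mulrCA exprS.
have -> : \sum_(i < m.+1) (('C(m, i)%:R * c ^+ i) *: Q^`(m - i))^`() =
    Q^`(m.+1) + \sum_(i < m.+1) ('C(m, i.+1)%:R * c ^+ i.+1) *: Q^`(m - i).
  rewrite big_ord_recl big_ord_recr /= subn0 bin0 expr0 mulr1 scale1r.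
  rewrite bin_small // mul0r scale0r addr0; congr (_ + _).
  apply: eq_bigr => i _; rewrite /bump leq0n add1n derivZ -derivnS.
  by rewrite subnSK.
rewrite [RHS]big_ord_recl bin0 expr0 mulr1 scale1r subn0 addrCA; congr (_ + _).
rewrite addrC -big_split /=; apply: eq_bigr => i _.
by rewrite /bump leq0n add1n subSS binS natrD mulrDl scalerDl.
Qed.

Lemma comp_shifted_hermite (C : comNzRingType) (p : C) (m : nat) :
  shifted_hermite 0 m \Po ('X + p%:P) = shifted_hermite (2 * p) m.
Proof.
elim: m => [|m IH]; first by rewrite /= -[1]/(1%:P) comp_polyC.
have dXp : ('X + p%:P)^`() = 1 by rewrite derivD derivX derivC addr0.
rewrite !shifted_hermiteS -IH deriv_comp dXp mulr1.
rewrite rmorphB rmorphM rmorphD /= comp_polyZ comp_polyX comp_polyC addr0.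
by rewrite scalerDr -(mul_polyC 2 p%:P) polyCM.
Qed.

Lemma map_shifted_hermite (A B : comNzRingType) (f : {rmorphism A -> B})
    (b : A) (m : nat) :
  map_poly f (shifted_hermite b m) = shifted_hermite (f b) m.
Proof.
elim: m => [|m IH]; first exact: rmorph1.
rewrite !shifted_hermiteS -IH rmorphB rmorphM rmorphD /= deriv_map.
by rewrite linearZ /= map_polyX map_polyC rmorph_nat.
Qed.

(** * Functionals satisfying integration by parts *)

(** A linear functional [E] satisfying [E_parts] behaves like integration against
    [exp (- s ^ 2 + z * s)]: the hypothesis says that the integral of a derivative
    vanishes. It determines [E] up to the factor [E 1]. *)
Section functional.
Variables (C : comNzRingType) (E : {linear {poly C} -> C | *%R}) (z : C).
Hypothesis E_parts : forall P, E (2 *: ('X * P) - P^`()) = z * E P.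

(** Integration by parts moves the raising operator off [P]. *)
Lemma functional_raise (b : C) (P Q : {poly C}) :
  E (Q * hermite_raise b P) = E (hermite_raise_dual (z + b) Q * P).
Proof.
have -> : Q * hermite_raise b P =
    (2 *: ('X * (Q * P)) - (Q * P)^`()) + b *: (Q * P) + Q^`() * P.
  by rewrite /hermite_raise derivM -!mul_polyC; ring.
rewrite /hermite_raise_dual mulrDl -scalerAl 2!linearD E_parts linearD !linearZ /=.
by rewrite mulrDl.
Qed.

Lemma functional_shifted_hermite_mul (b : C) (m : nat) (Q : {poly C}) :
  E (Q * shifted_hermite b m) = E (iter m (hermite_raise_dual (z + b)) Q).
Proof.
elim: m Q => [|m IH] Q; first by rewrite mulr1.
by rewrite /shifted_hermite iterS functional_raise iterSr IH.
Qed.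

Lemma functional_shifted_hermite (b : C) (m : nat) :
  E (shifted_hermite b m) = (z + b) ^+ m * E 1.
Proof.
rewrite -[shifted_hermite b m]mul1r functional_shifted_hermite_mul.
have -> : iter m (hermite_raise_dual (z + b)) 1 = (z + b) ^+ m *: 1.
  elim: m => [|m IH]; first by rewrite scale1r.
  rewrite iterS IH /hermite_raise_dual derivZ -[1]/(1%:P) derivC scaler0 addr0.
  by rewrite scalerA exprS.
by rewrite linearZ.
Qed.

(** Moving the [m] raising operators of one factor onto the other turns them into
    derivatives. The derivatives of a shifted Hermite polynomial are multiples of
    lower ones, on which [E] is a power of [z + b'] times [E 1]. *)
Lemma functional_hermite_product (b b' : C) (m : nat) :
  E (shifted_hermite b' m * shifted_hermite b m) =
  (\sum_(i < m.+1) 'C(m, i)%:R * 2 ^+ (m - i) * (m ^_ (m - i))%:R *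
     ((z + b) * (z + b')) ^+ i) * E 1.
Proof.
rewrite functional_shifted_hermite_mul iter_hermite_raise_dual linear_sum mulr_suml.
apply: eq_bigr => i _.
have im : (i <= m)%N by rewrite -ltnS.
rewrite linearZ /= derivn_shifted_hermite ?leq_subr // linearZ /= subKn //.
by rewrite functional_shifted_hermite exprMn; ring.
Qed.
End functional.

(** * Functions of Gaussian decay *)

(** The bound uses half of the exponent of [exp (- s ^ 2)], which leaves room to
    absorb polynomial factors. Continuity is included because it is what
    measurability, the fundamental theorem and the translation of integrals need. *)
Definition gaussian_decay (R : realType) (f : R -> R) : Prop :=
  continuous f /\ exists C : R, forall s, `|f s| <= C * expR (- s ^+ 2 / 2).

Section decay.
Context {R : realType}.
Implicit Types f g F : R -> R.
Let mu := @lebesgue_measure R.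

Lemma gaussian_decay_cst0 : gaussian_decay (fun _ : R => 0).
Proof.
split; first by move=> s; exact: cvg_cst.
by exists 0 => s; rewrite normr0 mul0r.
Qed.

Lemma gaussian_decayD f g : gaussian_decay f -> gaussian_decay g ->
  gaussian_decay (fun s => f s + g s).
Proof.
move=> [cf [C Cf]] [cg [D Dg]]; split.
  by move=> s; apply: cvgD; [exact: cf|exact: cg].
exists (C + D) => s; rewrite mulrDl (le_trans (ler_normD _ _))//.
by rewrite lerD.
Qed.

Lemma gaussian_decayZ (a : R) f : gaussian_decay f ->
  gaussian_decay (fun s => a * f s).
Proof.
move=> [cf [C Cf]]; split.
  by move=> s; apply: cvgM; [exact: cvg_cst|exact: cf].
by exists (`|a| * C) => s; rewrite normrM -mulrA ler_wpM2l.
Qed.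

Lemma gaussian_decayM f g : gaussian_decay f -> continuous g ->
  (forall s, `|g s| <= 1) -> gaussian_decay (fun s => f s * g s).
Proof.
move=> [cf [C Cf]] cg g1; split.
  by move=> s; apply: cvgM; [exact: cf|exact: cg].
exists C => s; rewrite normrM (le_trans _ (Cf s))//.
by rewrite ler_piMr.
Qed.

Lemma continuous_gaussian_monomial (k : nat) :
  continuous (fun s : R => s ^+ k * expR (- s ^+ 2)).
Proof.
move=> s; apply: cvgM; first exact: exprn_continuous.
exact: continuous_gauss_fun.
Qed.

(** A power of [y = s ^ 2 / 2] is bounded by a multiple of [exp y], as one term of
    the exponential series. *)
Lemma gaussian_decay_monomial (k : nat) :
  gaussian_decay (fun s : R => s ^+ k * expR (- s ^+ 2)).
Proof.
split; first exact: continuous_gaussian_monomial.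
exists (1 + 2 ^+ k * (k`!)%:R) => s.
pose y : R := s ^+ 2 / 2.
have y0 : 0 <= y by rewrite divr_ge0// sqr_ge0.
have ey1 : 1 <= expR y by rewrite -expR0 ler_expR.
have yk : y ^+ k <= (k`!)%:R * expR y.
  rewrite mulrC -ler_pdivrMr ?ltr0n ?fact_gt0//.
  case: k => [|k]; first by rewrite expr0 divr1.
  by rewrite (le_trans _ (expR_ge1Dxn k y0))// lerDr.
have sk : `|s ^+ k| <= (1 + 2 ^+ k * (k`!)%:R) * expR y.
  apply: (@le_trans _ _ (1 + (2 * y) ^+ k)).
    have -> : 2 * y = s ^+ 2 by rewrite /y mulrC divfK.
    (* Only even powers are powers of y; odd ones are covered by z <= 1 + z ^ 2. *)
    rewrite -exprM mulnC exprM -(real_normK (num_real (s ^+ k))).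
    set z := `|s ^+ k|.
    have [z1|/ltW z1] := leP z 1; first by rewrite (le_trans z1)// lerDl sqr_ge0.
    by rewrite (@le_trans _ _ (z ^+ 2))// ?lerDr// expr2 ler_peMl// normr_ge0.
  by rewrite exprMn mulrDl mul1r lerD// -mulrA ler_wpM2l.
have -> : expR (- s ^+ 2) = expR (- y) * expR (- s ^+ 2 / 2).
  by rewrite -expRD; congr expR; rewrite /y; lra.
rewrite mulrA normrM (ger0_norm (expR_ge0 _)) ler_wpM2r ?expR_ge0//.
by rewrite normrM (ger0_norm (expR_ge0 _)) expRN ler_pdivrMr// expR_gt0.
Qed.

(** The dominating function is a multiple of the standard normal density. *)
Lemma integrable_gaussian_decay f : gaussian_decay f ->
  mu.-integrable setT (EFin \o f).
Proof.
move=> [cf [C Cf]].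
have mf : measurable_fun setT f by exact: continuous_measurable_fun.
pose p := @normal_pdf R 0 1.
have pE s : expR (- s ^+ 2 / 2) = (normal_peak 1)^-1 * p s.
  rewrite /p normal_pdfE ?oner_eq0// mulKf; last first.
    by rewrite gt_eqF// normal_peak_gt0// oner_eq0.
  by rewrite /normal_fun subr0 expr1n.
apply: (@le_integrable _ _ _ mu _ measurableT _
  (fun s => ((C * (normal_peak 1)^-1)%:E * (p s)%:E)%E)).
- exact/measurable_EFinP.
- move=> s _ /=; rewrite lee_fin (le_trans (Cf s))// pE mulrA.
  exact: ler_norm.
- by apply: integrableZl => //; exact: integrable_normal_pdf.
Qed.

End decay.

(** * Integration over the line: translations and derivatives *)

Section line.
Context {R : realType}.
Let mu := @lebesgue_measure R.

(** Change of variables for a nonnegative continuous function, applied to the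
    positive and negative parts; both sides carry the same junk value when [f] is
    not integrable, so continuity suffices. *)
Lemma integral_shift (f : R -> R) (c : R) : continuous f ->
  \int[mu]_t f t = \int[mu]_s f (s + c).
Proof.
move=> cf.
have key (g : R -> R) : continuous g -> (forall t, 0 <= g t) ->
    (\int[mu]_t (g t)%:E = \int[mu]_s (g (s + c))%:E)%E.
  move=> cg g0.
  have dE : ((fun s : R => s + c)^`())%classic = cst 1.
    apply/funext => s; rewrite derive1E.
    by have /@derive_val := is_derive_shift s 1 c.
  rewrite (@increasing_ge0_integration_by_substitutionT _ (fun s => s + c))//.
  - by apply: eq_integral => s _; rewrite dE !fctE mulr1.
  - by move=> x y xy; rewrite ltrD2r.
  - by rewrite dE => s; exact: cvg_cst.
  - by rewrite dE; exact: is_cvg_cst.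
  - by rewrite dE; exact: is_cvg_cst.
  - exact: cvg_addrr_Ny.
  - exact: cvg_addrr.
congr fine; rewrite integralE [RHS]integralE; congr (_ - _)%E.
  under eq_integral do rewrite funeposE -EFin_max.
  under [RHS]eq_integral do rewrite funeposE -EFin_max.
  apply: (key (fun t => Num.max (f t) 0)) => [t|t]; last by rewrite le_max lexx orbT.
  by apply: (@continuous_max _ _ f (cst 0)); [exact: cf|exact: cvg_cst].
under eq_integral do rewrite funenegE -EFinN -EFin_max.
under [RHS]eq_integral do rewrite funenegE -EFinN -EFin_max.
apply: (key (fun t => Num.max (- f t) 0)) => [t|t]; last by rewrite le_max lexx orbT.
apply: (@continuous_max _ _ (fun t => - f t) (cst 0)); last exact: cvg_cst.
by apply: cvgN; exact: cf.
Qed.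

Lemma gaussian_decay_cvg0 (f : R -> R) : gaussian_decay f ->
  (f n.+1%:R @[n --> \oo] --> (0 : R)) /\ (f (- n.+1%:R) @[n --> \oo] --> (0 : R)).
Proof.
move=> [_ [C Cf]].
have C0 : 0 <= C.
  by rewrite -(pmulr_lge0 _ (expR_gt0 (- 0 ^+ 2 / 2))) (le_trans _ (Cf 0)).
have bound (s : R) (n : nat) : `|s| = n.+1%:R -> `|f s| <= C * harmonic n.
  move=> sn; rewrite (le_trans (Cf s))//= ler_wpM2l// mulNr expRN.
  rewrite lef_pV2 ?posrE ?expR_gt0// (le_trans _ (expR_ge1Dx _))//.
  rewrite -(real_normK (num_real s)) sn -subr_ge0.
  have -> : 1 + n.+1%:R ^+ 2 / 2 - n.+1%:R = ((n.+1%:R - 1) ^+ 2 + 1) / 2 :> R.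
    by field.
  by rewrite divr_ge0// addr_ge0// sqr_ge0.
have h0 : C * harmonic n @[n --> \oo] --> (0 : R).
  by rewrite -(mulr0 C); apply: cvgM; [exact: cvg_cst|exact: cvg_harmonic].
split; apply: norm_cvg0; apply: (squeeze_cvgr _ (cvg_cst 0) h0);
  apply: nearW => n; rewrite normr_ge0/=; apply: bound.
  by rewrite ger0_norm.
by rewrite normrN ger0_norm.
Qed.

(** On symmetric intervals the fundamental theorem leaves boundary terms, which
    decay as the intervals grow; dominated convergence identifies the limit. *)
Lemma integral_derivative (F f : R -> R) :
  (forall s : R, is_derive s 1 F (f s)) -> gaussian_decay F -> gaussian_decay f ->
  \int[mu]_s f s = 0.
Proof.
move=> dF gF gf; have [cf _] := gf.
have cF : continuous F by case: gF.
have intf := integrable_gaussian_decay gf.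
pose I (n : nat) : set R := `[- n.+1%:R, n.+1%:R]%classic.
have FTC n : (\int[mu]_s ((EFin \o f) \_ (I n)) s = (F n.+1%:R - F (- n.+1%:R))%:E)%E.
  rewrite -integral_mkcond EFinB.
  apply: continuous_FTC2.
  - by rewrite -subr_gt0 opprK addr_gt0.
  - exact: continuous_subspaceT.
  - split=> [x _||]; first by [].
    + by apply: cvg_at_right_filter; exact: cF.
    + by apply: cvg_at_left_filter; exact: cF.
  - by move=> x _; rewrite derive1E derive_val.
have mf : measurable_fun setT (EFin \o f) by exact: (measurable_int mu).
have [| | | | |_ _ cvgf] := @dominated_convergence _ _ _ mu setT measurableT
  (fun n => (EFin \o f) \_ (I n)) (EFin \o f) (fun s => `|f s|%:E).
- move=> n; apply/(measurable_restrictT _ _).1; first exact: measurable_itv.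
  exact: measurable_funTS.
- exact: mf.
- apply: aeW => s _; apply: cvg_near_cst.
  near=> n; rewrite patchE mem_set// /I/= in_itv/= -ler_norml.
  by rewrite -nat1r -lerBlDl; near: n; exact: nbhs_infty_ger.
- exact: integrable_norm.
- apply: aeW => s n _; rewrite patchE; case: ifPn => _ //=.
  by rewrite normr0 lee_fin normr_ge0.
have [Fp Fm] := gaussian_decay_cvg0 gF.
have : (F n.+1%:R - F (- n.+1%:R))%:E @[n --> \oo] --> (0 : R)%:E.
  apply: cvg_EFin; first exact: nearW.
  by rewrite -[X in _ --> X](subr0 0); apply: cvgB.
under eq_fun do rewrite -FTC.
move=> cvg0; rewrite /Rintegral.
by rewrite (cvg_unique _ cvgf cvg0).
Unshelve. all: by end_near. Qed.
End line.

(** * Fourier transform of the Gaussian *)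

Section fourier.
Context {R : realType}.
Let mu := @lebesgue_measure R.

Lemma is_derive_gaussian (s : R) :
  is_derive s 1 (fun t : R => expR (- t ^+ 2)) (- (2 * s) * expR (- s ^+ 2)).
Proof.
have d2 : is_derive s 1 (fun t : R => - t ^+ 2) (- (2 * s)).
  apply: trigger_derive.
  by rewrite /GRing.scale /=; ring.
have d := @is_derive1_comp _ expR (fun t => - t ^+ 2) s _ _ (is_derive_expR _) d2.
by apply: is_derive_eq d _; rewrite mulrC.
Qed.

Lemma is_derive_mul (f g : R -> R) (s a b : R) :
  is_derive s 1 f a -> is_derive s 1 g b ->
  is_derive s 1 (fun t => f t * g t) (f s * b + g s * a).
Proof. by move=> df dg; exact: is_deriveM. Qed.

Lemma is_derive_exprn (k : nat) (s : R) :
  is_derive s 1 (fun t : R => t ^+ k) (k%:R * s ^+ k.-1).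
Proof.
have := @is_deriveX _ _ id k s 1 1 (is_derive_id s 1).
by rewrite exprfctE /GRing.scale /= mulr1.
Qed.

(** The derivative of [s ^ k * exp (- s ^ 2) * g s] integrates to zero. For [k = 0]
    the default [0.-1 = 0] is harmless, its coefficient being zero. The pair
    [(g, h)] will be the cosine and the sine, in either order. *)
Lemma gaussian_moment_parts (k : nat) (g h : R -> R) (a : R) :
  (forall s : R, is_derive s 1 g (a * h s)) -> continuous h ->
  (forall s, `|g s| <= 1) -> (forall s, `|h s| <= 1) ->
  2 * \int[mu]_s (s ^+ k.+1 * expR (- s ^+ 2) * g s) =
  k%:R * \int[mu]_s (s ^+ k.-1 * expR (- s ^+ 2) * g s)
  + a * \int[mu]_s (s ^+ k * expR (- s ^+ 2) * h s).
Proof.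
move=> dg ch g1 h1.
have cg : continuous g.
  by move=> s; apply/differentiable_continuous/derivable1_diffP.
pose m j (w : R -> R) (s : R) : R := s ^+ j * expR (- s ^+ 2) * w s.
have gg j : gaussian_decay (m j g).
  by apply: gaussian_decayM => //; exact: gaussian_decay_monomial.
have gh j : gaussian_decay (m j h).
  by apply: gaussian_decayM => //; exact: gaussian_decay_monomial.
have dm (s : R) : is_derive s 1 (m k g)
    (k%:R * m k.-1 g s + (a * m k h s + (-2) * m k.+1 g s)).
  apply: is_derive_eq.
    apply: is_derive_mul (dg s); apply: is_derive_mul (is_derive_gaussian s).
    exact: is_derive_exprn.
  by rewrite /m (exprS s k); ring.
have D1 := gaussian_decayZ k%:R (gg k.-1).
have D2 := gaussian_decayZ a (gh k).
have D3 := gaussian_decayZ (-2) (gg k.+1).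
have D23 := gaussian_decayD D2 D3.
have := integral_derivative dm (gg k) (gaussian_decayD D1 D23).
have I := @integrable_gaussian_decay R.
rewrite RintegralD//; [|exact: I|exact: I].
rewrite RintegralD//; [|exact: I|exact: I].
rewrite !RintegralZl//; [|exact: I|exact: I|exact: I].
rewrite -/(mu) /m => H.
by apply/eqP; rewrite -subr_eq0 -oppr_eq0 -[X in _ == X]H; apply/eqP; ring.
Qed.

Lemma is_derive_cos_affine (c d s : R) :
  is_derive s 1 (fun t => cos (c * t + d)) (c * - sin (c * s + d)).
Proof.
have da : is_derive s 1 (fun t : R => c * t + d) c.
  by apply: trigger_derive; rewrite /GRing.scale /= addr0 mulr1.
have dc := @is_derive1_comp _ cos (fun t => c * t + d) s _ _ (is_derive_cos _) da.
by apply: is_derive_eq dc _; rewrite mulrC.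
Qed.

Lemma is_derive_sin_affine (c d s : R) :
  is_derive s 1 (fun t => sin (c * t + d)) (c * cos (c * s + d)).
Proof.
have da : is_derive s 1 (fun t : R => c * t + d) c.
  by apply: trigger_derive; rewrite /GRing.scale /= addr0 mulr1.
have dc := @is_derive1_comp _ sin (fun t => c * t + d) s _ _ (is_derive_sin _) da.
by apply: is_derive_eq dc _; rewrite mulrC.
Qed.

Lemma continuous_cos_affine (c d : R) : continuous (fun t : R => cos (c * t + d)).
Proof.
by move=> s; have ? := is_derive_cos_affine c d s;
  apply/differentiable_continuous/derivable1_diffP.
Qed.

Lemma continuous_sin_affine (c d : R) : continuous (fun t : R => sin (c * t + d)).
Proof.
by move=> s; have ? := is_derive_sin_affine c d s;
  apply/differentiable_continuous/derivable1_diffP.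
Qed.

Lemma gaussian_decay_cos k (c d : R) :
  gaussian_decay (fun s => s ^+ k * expR (- s ^+ 2) * cos (c * s + d)).
Proof.
apply: gaussian_decayM; first exact: gaussian_decay_monomial.
  exact: continuous_cos_affine.
by move=> s; exact: cos_max.
Qed.

Lemma gaussian_decay_sin k (c d : R) :
  gaussian_decay (fun s => s ^+ k * expR (- s ^+ 2) * sin (c * s + d)).
Proof.
apply: gaussian_decayM; first exact: gaussian_decay_monomial.
  exact: continuous_sin_affine.
by move=> s; exact: sin_max.
Qed.

(** As a function of [xi] the integral solves [phi' = - (xi / 2) * phi]: one
    differentiates under the integral sign and integrates by parts. Its value at
    zero is [cos theta] times the Gauss integral. The phase [theta] treats the cosine and the sine
    transforms at once. *)
Lemma gaussian_cos_transform (xi theta : R) :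
  \int[mu]_s (expR (- s ^+ 2) * cos (xi * s + theta)) =
  Num.sqrt pi * expR (- xi ^+ 2 / 4) * cos theta.
Proof.
pose phi (x : R) := \int[mu]_s (expR (- s ^+ 2) * cos (x * s + theta)).
have dphi (x : R) : is_derive x 1 phi (- (x / 2) * phi x).
  pose f (x s : R) : R := expR (- s ^+ 2) * cos (x * s + theta).
  have df (y s : R) : is_derive y 1 (f ^~ s)
      (- (s ^+ 1 * expR (- s ^+ 2) * sin (y * s + theta))).
    have cE : (f ^~ s) = (fun y => expR (- s ^+ 2) * cos (s * y + theta)).
      by apply/funext => z; rewrite /f (mulrC z).
    have dc := @is_derive_mul (cst (expR (- s ^+ 2))) _ y _ _
      (is_derive_cst _ _ _) (is_derive_cos_affine s theta y).
    rewrite cE; apply: is_derive_eq dc _.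
    by rewrite (mulrC s y) expr1 /=; ring.
  have d1E y s : partial1of2 f y s = - (s ^+ 1 * expR (- s ^+ 2) * sin (y * s + theta)).
    by rewrite partial1of2E; have /@derive_val := df y s.
  have Hint y : mu.-integrable setT (EFin \o f y).
    apply: integrable_gaussian_decay.
    rewrite (_ : f y = fun s => s ^+ 0 * expR (- s ^+ 2) * cos (y * s + theta)).
      exact: gaussian_decay_cos.
    by apply/funext => s; rewrite expr0 mul1r.
  have HG : mu.-integrable setT (EFin \o (fun s : R => `|s ^+ 1 * expR (- s ^+ 2)|)).
    exact: (integrable_norm (integrable_gaussian_decay (gaussian_decay_monomial 1))).
  have xI : x \in `]x - 1, x + 1[.
    by rewrite in_itv/= ltrBlDr ltrDl ltr01.
  have Hd y s : derivable (f ^~ s) y 1 by have [] := df y s.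
  have Hub y s : `|partial1of2 f y s| <= `|s ^+ 1 * expR (- s ^+ 2)|.
    rewrite d1E normrN normrM ler_piMr// ?normr_ge0//.
    exact: sin_max.
  have Hder := @derivable_under_integral R _ _ mu f setT measurableT x _ _ xI
     (fun y _ => Hint y) (fun y s _ _ => Hd y s) _ (fun s => normr_ge0 _) HG
     (fun y s _ _ => Hub y s).
  have Hval := @differentiation_under_integral R _ _ mu f setT measurableT x _ _ xI
     (fun y _ => Hint y) (fun y s _ _ => Hd y s) _ (fun s => normr_ge0 _) HG
     (fun y s _ _ => Hub y s).
  apply: DeriveDef; first exact: Hder.
  rewrite -derive1E Hval.
  under eq_Rintegral do rewrite d1E -mulrN.
  (* The factor s brought down by differentiation turns the Gaussian into minus
     half its derivative. *)
  have := @gaussian_moment_parts 0 (fun s => sin (x * s + theta))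
    (fun s => cos (x * s + theta)) x
    (is_derive_sin_affine x theta) (@continuous_cos_affine x theta)
    (fun s => sin_max _) (fun s => cos_max _).
  rewrite mul0r add0r.
  under [X in _ = _ * X]eq_Rintegral do rewrite expr0 mul1r.
  rewrite -/(phi x) => H.
  have -> : \int[mu]_s (s ^+ 1 * expR (- s ^+ 2) * - sin (x * s + theta)) =
     - \int[mu]_s (s ^+ 1 * expR (- s ^+ 2) * sin (x * s + theta)).
    under eq_Rintegral do rewrite mulrN -mulN1r.
    rewrite RintegralZl ?mulN1r//.
    exact/integrable_gaussian_decay/gaussian_decay_sin.
  by move: H; lra.
(* The integrating factor of the differential equation. *)
pose psi x := phi x * expR (x ^+ 2 / 4).
have dpsi (x : R) : is_derive x 1 psi 0.
  have dq : is_derive x 1 (fun t : R => t ^+ 2 / 4) (x / 2).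
    apply: trigger_derive; rewrite /GRing.scale /=; by field.
  have de := @is_derive1_comp _ expR (fun t => t ^+ 2 / 4) x _ _ (is_derive_expR _) dq.
  have dm := is_derive_mul (dphi x) de.
  by apply: is_derive_eq dm _; rewrite /=; ring.
have psi0 : psi 0 = Num.sqrt pi * cos theta.
  rewrite /psi expr0n/= mul0r expR0 mulr1 /phi.
  under eq_Rintegral do rewrite mul0r add0r.
  rewrite RintegralZr//; last exact: integrableT_gauss.
  by rewrite /Rintegral integralT_gauss.
have := is_derive_0_is_cst xi 0 dpsi.
rewrite psi0 /psi -/(phi xi) => H.
by rewrite mulrAC -H -mulrA -expRD -mulrDl addrN mul0r expR0 mulr1.
Qed.
End fourier.

(** * Complex integrals against a Gaussian wave *)

Definition gaussian_decayC (R : realType) (f : R -> R[i]) : Prop :=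
  gaussian_decay (fun s => complex.Re (f s)) /\
  gaussian_decay (fun s => complex.Im (f s)).

Section complex_integral.
Context {R : realType}.
Implicit Types f g : R -> R[i].
Let mu := @lebesgue_measure R.

Lemma expCD (z w : R[i]) : expC (z + w) = expC z * expC w.
Proof.
case: z w => [a b] [c d]; rewrite /expC /= expRD cosD sinD.
by apply/eqP; rewrite eq_complex /=; apply/andP; split; apply/eqP; ring.
Qed.

Lemma expC_real (a : R) : expC a%:C = (expR a)%:C.
Proof. by rewrite /expC /= cos0 sin0 mulr1 mulr0. Qed.

Lemma expC_imag (a : R) : expC ('i%C * a%:C) = cos a +i* sin a.
Proof.
have -> : 'i%C * a%:C = 0 +i* a :> R[i].
  by apply/eqP; rewrite eq_complex /= !mul0r !mul1r subr0 add0r !eqxx.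
by rewrite /expC expR0 !mul1r.
Qed.

Lemma gaussian_decayCD f g : gaussian_decayC f -> gaussian_decayC g ->
  gaussian_decayC (fun s => f s + g s).
Proof.
move=> [fR fI] [gR gI]; split.
  have := gaussian_decayD fR gR; congr gaussian_decay.
  by apply/funext => s; case: (f s) (g s) => ? ? [].
have := gaussian_decayD fI gI; congr gaussian_decay.
by apply/funext => s; case: (f s) (g s) => ? ? [].
Qed.

Lemma gaussian_decayCZ (c : R[i]) f : gaussian_decayC f ->
  gaussian_decayC (fun s => c * f s).
Proof.
case: c => a b [fR fI]; split.
  have := gaussian_decayD (gaussian_decayZ a fR) (gaussian_decayZ (- b) fI).
  congr gaussian_decay; apply/funext => s; case: (f s) => ? ? /=.
  by rewrite mulNr.
have := gaussian_decayD (gaussian_decayZ a fI) (gaussian_decayZ b fR).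
by congr gaussian_decay; apply/funext => s; case: (f s).
Qed.

Lemma gaussian_decayC_sum (I : Type) (r : seq I) (F : I -> R -> R[i]) :
  (forall i, gaussian_decayC (F i)) ->
  gaussian_decayC (fun s => \sum_(i <- r) F i s).
Proof.
move=> gF; elim: r => [|i r IH].
  under eq_fun do rewrite big_nil.
  by split; exact: gaussian_decay_cst0.
under eq_fun do rewrite big_cons.
exact: gaussian_decayCD.
Qed.

Lemma CintegralD f g : gaussian_decayC f -> gaussian_decayC g ->
  Cintegral (fun s => f s + g s) = Cintegral f + Cintegral g.
Proof.
move=> [fR fI] [gR gI]; apply/eqP; rewrite eq_complex /=; apply/andP.
have I := @integrable_gaussian_decay R.
split; apply/eqP; rewrite -RintegralD//; try exact: I;
  by apply: eq_Rintegral => s _; case: (f s) (g s) => ? ? [].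
Qed.

Lemma CintegralZ (c : R[i]) f : gaussian_decayC f ->
  Cintegral (fun s => c * f s) = c * Cintegral f.
Proof.
case: c => a b [fR fI]; apply/eqP; rewrite eq_complex /=; apply/andP.
have I := @integrable_gaussian_decay R.
split; apply/eqP.
  rewrite -!RintegralZl//; try exact: I.
  rewrite -RintegralB//; try by apply: I; exact: gaussian_decayZ.
  by apply: eq_Rintegral => s _; case: (f s) => ? ?.
rewrite -!RintegralZl//; try exact: I.
rewrite -RintegralD//; try by apply: I; exact: gaussian_decayZ.
by apply: eq_Rintegral => s _; case: (f s) => ? ?.
Qed.

Lemma Cintegral_sum (I : Type) (r : seq I) (F : I -> R -> R[i]) :
  (forall i, gaussian_decayC (F i)) ->
  Cintegral (fun s => \sum_(i <- r) F i s) = \sum_(i <- r) Cintegral (F i).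
Proof.
move=> gF; elim: r => [|i r IH].
  under eq_fun do rewrite big_nil.
  by rewrite big_nil /Cintegral /= /Rintegral integral0.
under eq_fun do rewrite big_cons.
by rewrite big_cons CintegralD ?IH//; exact: gaussian_decayC_sum.
Qed.

(** Decay is asked of the translate because, in the application, the recentred
    integrand is the one that has an explicit Gaussian factor. *)
Lemma Cintegral_shift f (c : R) : gaussian_decayC (fun s => f (s + c)) ->
  Cintegral f = Cintegral (fun s => f (s + c)).
Proof.
move=> [[cR _] [cI _]]; rewrite /Cintegral.
rewrite (integral_shift (- c) cR) (integral_shift (- c) cI).
by under [in RHS]eq_Rintegral do rewrite subrK;
  under [X in _ = _ +i* X]eq_Rintegral do rewrite subrK.
Qed.

Definition gaussian_wave (xi s : R) : R[i] :=
  (expR (- s ^+ 2))%:C * expC ('i%C * xi%:C * s%:C).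

Lemma gaussian_monomialE k (xi s : R) :
  s%:C ^+ k * gaussian_wave xi s =
  (s ^+ k * expR (- s ^+ 2) * cos (xi * s + 0)) +i*
  (s ^+ k * expR (- s ^+ 2) * sin (xi * s + 0)).
Proof.
rewrite /gaussian_wave.
have -> : 'i%C * xi%:C * s%:C = 'i%C * (xi * s)%:C by rewrite -mulrA rmorphM.
rewrite expC_imag -rmorphXn mulrA -rmorphM addr0 /=.
by apply/eqP; rewrite eq_complex /= !mul0r subr0 addr0 !eqxx.
Qed.

Lemma gaussian_decayC_monomial k (xi : R) :
  gaussian_decayC (fun s => s%:C ^+ k * gaussian_wave xi s).
Proof.
split; under eq_fun do rewrite gaussian_monomialE /=.
  exact: gaussian_decay_cos.
exact: gaussian_decay_sin.
Qed.

Lemma gaussian_decayC_poly (P : {poly R[i]}) (xi : R) :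
  gaussian_decayC (fun s => P.[s%:C] * gaussian_wave xi s).
Proof.
under eq_fun do rewrite horner_coef mulr_suml.
apply: gaussian_decayC_sum => i.
under eq_fun do rewrite -mulrA.
exact/gaussian_decayCZ/gaussian_decayC_monomial.
Qed.

(** Integration of a polynomial against [exp (- s ^ 2 + i * xi * s)]. Complex
    coefficients are needed although the Hermite polynomials are real, since the
    dual raising operator multiplies by complex scalars. *)
Definition gaussian_functional (xi : R) (P : {poly R[i]}) : R[i] :=
  Cintegral (fun s => P.[s%:C] * gaussian_wave xi s).

Lemma gaussian_functional_linear (xi : R) :
  linear_for *%R (gaussian_functional xi).
Proof.
move=> c P Q; rewrite /gaussian_functional.
under eq_fun do rewrite hornerD hornerZ mulrDl -mulrA.
rewrite CintegralD ?CintegralZ//; try exact: gaussian_decayC_poly.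
exact/gaussian_decayCZ/gaussian_decayC_poly.
Qed.

HB.instance Definition _ (xi : R) :=
  GRing.isLinear.Build R[i] {poly R[i]} R[i] *%R (gaussian_functional xi)
    (gaussian_functional_linear xi).

Lemma gaussian_functionalXn (xi : R) (k : nat) :
  gaussian_functional xi 'X^k =
  (\int[mu]_s (s ^+ k * expR (- s ^+ 2) * cos (xi * s + 0))) +i*
  (\int[mu]_s (s ^+ k * expR (- s ^+ 2) * sin (xi * s + 0))).
Proof.
rewrite /gaussian_functional; under eq_fun do rewrite hornerXn gaussian_monomialE.
by [].
Qed.

(** The sine is a cosine with phase [- pi / 2], whose cosine is zero: the imaginary
    part vanishes. *)
Lemma gaussian_functional1 (xi : R) :
  gaussian_functional xi 1 = (Num.sqrt pi * expR (- xi ^+ 2 / 4))%:C.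
Proof.
rewrite -(expr0 'X) gaussian_functionalXn; apply/eqP.
rewrite eq_complex /=; apply/andP; split; apply/eqP.
  under eq_Rintegral do rewrite expr0 mul1r.
  by rewrite gaussian_cos_transform cos0 mulr1.
under eq_Rintegral do rewrite expr0 mul1r -cosBpihalf -addrA.
by rewrite gaussian_cos_transform add0r cosN cos_pihalf mulr0.
Qed.

(** By linearity this is a statement on monomials, whose real and imaginary parts
    are the two instances of [gaussian_moment_parts]. *)
Lemma gaussian_functional_parts (xi : R) (P : {poly R[i]}) :
  gaussian_functional xi (2 *: ('X * P) - P^`()) =
  'i%C * xi%:C * gaussian_functional xi P.
Proof.
have mono k : gaussian_functional xi (2 *: ('X * 'X^k) - 'X^k^`()) =
    'i%C * xi%:C * gaussian_functional xi 'X^k.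
  rewrite -exprS derivXn -(scaler_nat k) linearB !linearZ /= !gaussian_functionalXn.
  have Hc := @gaussian_moment_parts R k (fun s => cos (xi * s + 0))
    (fun s => sin (xi * s + 0)) (- xi).
  have Hs := @gaussian_moment_parts R k (fun s => sin (xi * s + 0))
    (fun s => cos (xi * s + 0)) xi (is_derive_sin_affine xi 0)
    (@continuous_cos_affine R xi 0) (fun s => sin_max _) (fun s => cos_max _).
  have dcos (s : R) : is_derive s 1 (fun t => cos (xi * t + 0))
      (- xi * sin (xi * s + 0)).
    by apply: is_derive_eq (is_derive_cos_affine xi 0 s) _; rewrite mulrN mulNr.
  have {}Hc := Hc dcos (@continuous_sin_affine R xi 0) (fun s => cos_max _)
    (fun s => sin_max _).
  move: Hc Hs.
  set c1 := (\int[_]_ _ _)%R; set c2 := (\int[_]_ _ _)%R; set c3 := (\int[_]_ _ _)%R.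
  set d1 := (\int[_]_ _ _)%R; set d2 := (\int[_]_ _ _)%R; set d3 := (\int[_]_ _ _)%R.
  move=> Hc Hs; rewrite -!(rmorph_nat (real_complex R)).
  by apply/eqP; rewrite eq_complex /=; apply/andP; split; apply/eqP; move: Hc Hs; lra.
rewrite -[P]coefK poly_def mulr_sumr scaler_sumr raddf_sum /= -sumrB !linear_sum mulr_sumr.
apply: eq_bigr => i _.
rewrite derivZ -scalerAr scalerA mulrC -scalerA -scalerBr !linearZ /= mono.
by rewrite mulrCA.
Qed.

End complex_integral.

(** * Hermite functions and their short-time Fourier transform *)

Section hermite_functions.
Context {R : realType}.

(** Differentiating [exp (- t ^ 2) * P t] amounts to applying minus the raising
    operator to [P]. *)
Lemma derive1n_gaussian (m : nat) :
  derive1n m (fun s : R => expR (- s ^+ 2)) =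
  (fun t => (-1) ^+ m * (expR (- t ^+ 2) * (shifted_hermite (0 : R) m).[t])).
Proof.
elim: m => [|m IH].
  by apply/funext => t; rewrite derive1n0 hornerC mulr1 mul1r.
rewrite derive1nS IH; apply/funext => t; rewrite derive1E.
pose P := shifted_hermite (0 : R) m.
have dm := is_derive_mul (is_derive_gaussian t) (is_derive_poly P t).
have dM := @is_derive_mul R (cst ((-1) ^+ m)) _ t _ _ (is_derive_cst _ _ _) dm.
rewrite (@derive_val _ _ _ _ _ _ _ dM) shifted_hermiteS -/P /=.
rewrite !hornerE /= (exprS (-1) m); ring.
Qed.

Lemma hermite_polyE (m : nat) (t : R) :
  hermite_poly m t = (shifted_hermite 0 m).[t].
Proof.
rewrite /hermite_poly derive1n_gaussian.
rewrite (_ : _ * _ = ((-1) ^+ m * (-1) ^+ m) * (expR (t ^+ 2) * expR (- t ^+ 2))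
  * (shifted_hermite 0 m).[t]); last by ring.
by rewrite -expr2 sqrr_sign expRxMexpNx_1 !mul1r.
Qed.

Lemma horner_shifted_hermite (p : R) (m : nat) (s : R) :
  (shifted_hermite 0 m).[s + p] = (shifted_hermite (2 * p) m).[s].
Proof.
by rewrite -comp_shifted_hermite horner_comp !hornerE.
Qed.

(** Centred at the midpoint of the two translates, the cross terms of the two
    Gaussians cancel. *)
Lemma hermite_fun_product (m : nat) (p s : R) :
  hermite_fun m (s + p) * hermite_fun m (s - p) =
  expR (- p ^+ 2) * expR (- s ^+ 2) *
  (shifted_hermite (2 * p) m * shifted_hermite (- (2 * p)) m).[s].
Proof.
rewrite /hermite_fun !hermite_polyE horner_shifted_hermite.
rewrite (horner_shifted_hermite (- p)) mulrN hornerM [LHS]mulrACA -!expRD.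
by congr (expR _ * _); field.
Qed.

(** The sum is in the shape produced by [functional_hermite_product]; it is matched
    termwise, the falling factorial being a quotient of factorials. *)
Lemma laguerreE (m : nat) (y : R) :
  \sum_(i < m.+1) 'C(m, i)%:R * 2 ^+ (m - i) * (m ^_ (m - i))%:R * (- (2 * y)) ^+ i
  = 2 ^+ m * (m`!)%:R * laguerre m y.
Proof.
rewrite /laguerre big_mkord mulr_sumr; apply: eq_bigr => i _.
have im : (i <= m)%N by rewrite -ltnS.
rewrite bin_sub // -[in X in _ = X](ffact_fact (leq_subr i m)) subKn // natrM.
rewrite -[in X in _ = 2 ^+ X * _ * _](subnK im) exprD (exprNn (2 * y)) (exprMn _ 2).
have i0 : (i`!)%:R != 0 :> R by rewrite pnatr_eq0 -lt0n fact_gt0.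
by field.
Qed.

(** The two shifts are opposite and the frequency is imaginary, so the base of the
    powers in [functional_hermite_product] is a difference of squares and equals
    [- (4 * p ^ 2 + xi ^ 2)]: this is how the Laguerre argument appears. *)
Lemma gaussian_functional_hermite (m : nat) (p xi : R) :
  gaussian_functional xi (map_poly (real_complex R)
    (shifted_hermite (2 * p) m * shifted_hermite (- (2 * p)) m)) =
  (2 ^+ m * (m`!)%:R * laguerre m ((4 * p ^+ 2 + xi ^+ 2) / 2)
   * (Num.sqrt pi * expR (- xi ^+ 2 / 4)))%:C.
Proof.
rewrite rmorphM /= !map_shifted_hermite.
rewrite (functional_hermite_product (gaussian_functional_parts xi)).
rewrite [RHS]rmorphM; congr (_ * _); last exact: gaussian_functional1.
rewrite -laguerreE rmorph_sum; apply: eq_bigr => i _.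
rewrite !rmorphM !rmorph_nat !rmorphXn /= rmorph_nat; congr (_ * _ ^+ _).
by apply/eqP; rewrite eq_complex /=; apply/andP; split; apply/eqP; field.
Qed.

(** Moving the origin to the midpoint [c] of the two centres splits the integrand
    into frequencies, each a scalar times a polynomial times a Gaussian wave. *)
Lemma stft_integrand_recentred (n m : nat) (a x u eta s : R) :
  let c := (u + x) / 2 in let p := (x - u) / 2 in
  expC (- 'i%C * (s + c)%:C * eta%:C) * conjc (hermite_fun m (s + c - u))%:C
    * hermite_superosc n m x (s + c) a =
  \sum_(0 <= j < n.+1)
    ((superosc_coef j n a)%:C * (expR (- p ^+ 2))%:C
      * expC ('i%C * ((superosc_freq R j n - eta) * c)%:C))
    * ((map_poly (real_complex R)
         (shifted_hermite (2 * p) m * shifted_hermite (- (2 * p)) m)).[s%:C]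
       * gaussian_wave (superosc_freq R j n - eta) s).
Proof.
move=> c p.
rewrite conjc_real /hermite_superosc /superosc mulrA mulr_sumr; apply: eq_bigr => j _.
have -> : s + c - u = s + p by rewrite /c /p; field.
have -> : s + c - x = s - p by rewrite /c /p; field.
rewrite -[X in X * _](mulrA (expC _)) -rmorphM hermite_fun_product 2!rmorphM.
rewrite horner_map /gaussian_wave.
set w := superosc_freq R j n.
set H := (_ * _).[_].
have E : expC (- 'i%C * (s + c)%:C * eta%:C) * expC ('i%C * w%:C * (s + c)%:C) =
  expC ('i%C * ((w - eta) * c)%:C) * expC ('i%C * (w - eta)%:C * s%:C).
  rewrite -!expCD; congr expC.
  by clearbody c; ring.
transitivity ((superosc_coef j n a)%:C * (expR (- p ^+ 2))%:C
  * (expR (- s ^+ 2))%:C * H%:C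
  * (expC (- 'i%C * (s + c)%:C * eta%:C) * expC ('i%C * w%:C * (s + c)%:C))).
  by ring.
rewrite E; ring.
Qed.

End hermite_functions.

Theorem proposition5p1 (R : realType) (n m : nat) (a x u eta : R)
  (hn : (0 < n)%N) (ha : 1 < a) :
  stft (fun t : R => (hermite_fun m t)%:C)
       (fun t : R => hermite_superosc n m x t a) u eta =
  (2 ^+ m * (m`!)%:R)%:C * (Num.sqrt pi)%:C
  * expC (((x * u)%:C - 'i%C * ((u + x) * eta)%:C) / 2)
  * (expR (- (x ^+ 2 + u ^+ 2 + eta ^+ 2) / 4))%:C
  * \sum_(0 <= j < n.+1)
      (superosc_coef j n a)%:C
      * expC (2^-1 * ('i%C * (superosc_freq R j n * (u + x))%:C
                      + (superosc_freq R j n * eta)%:C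
                      - (superosc_freq R j n ^+ 2 / 2)%:C))
      * (laguerre m (((x - u) ^+ 2 + (superosc_freq R j n - eta) ^+ 2) / 2))%:C.
Proof.
set c := (u + x) / 2; set p := (x - u) / 2.
have dec j : gaussian_decayC (fun s : R =>
    ((superosc_coef j n a)%:C * (expR (- p ^+ 2))%:C
      * expC ('i%C * ((superosc_freq R j n - eta) * c)%:C))
    * ((map_poly (real_complex R)
         (shifted_hermite (2 * p) m * shifted_hermite (- (2 * p)) m)).[s%:C]
       * gaussian_wave (superosc_freq R j n - eta) s)).
  exact/gaussian_decayCZ/gaussian_decayC_poly.
rewrite /stft (@Cintegral_shift _ _ c); last first.
  under eq_fun do rewrite stft_integrand_recentred.
  exact: gaussian_decayC_sum.
under eq_fun do rewrite stft_integrand_recentred.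
rewrite Cintegral_sum // mulr_sumr; apply: eq_bigr => j _.
rewrite CintegralZ; last exact: gaussian_decayC_poly.
rewrite -/(gaussian_functional _ _) gaussian_functional_hermite -/p.
set w := superosc_freq R j n.
have -> : (4 * p ^+ 2 + (w - eta) ^+ 2) / 2 = ((x - u) ^+ 2 + (w - eta) ^+ 2) / 2.
  by rewrite /p; field.
set L := laguerre _ _.
have -> : (2 ^+ m * (m`!)%:R * L * (Num.sqrt pi * expR (- (w - eta) ^+ 2 / 4)))%:C =
    (2 ^+ m * (m`!)%:R)%:C * L%:C
    * ((Num.sqrt pi)%:C * (expR (- (w - eta) ^+ 2 / 4))%:C).
  by rewrite !rmorphM.
rewrite -!expC_real.
set E1 := expC (- p ^+ 2)%:C; set E2 := expC ('i%C * _); set E3 := expC (_ / 4)%:C.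
set E4 := expC (_ / 2); set E5 := expC (_ / 4)%:C; set E6 := expC (2^-1 * _).
(* All the exponential prefactors merge into one exponent, which is then compared. *)
have E : E1 * E2 * E3 = E4 * E5 * E6.
  rewrite /E1 /E2 /E3 /E4 /E5 /E6 -!expCD; congr expC.
  by rewrite /p /c; field.
transitivity ((superosc_coef j n a)%:C
  * ((2 ^+ m * (m`!)%:R)%:C * L%:C * (Num.sqrt pi)%:C) * (E1 * E2 * E3)); first by ring.
rewrite E; ring.
Qed.
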